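(* Let $\alpha\in(0,2)$ and let $x_i=a+ih$, $i=0,1,\dots,N$, $h=(b-a)/N$, be a uniform grid. If the SOE tolerance $\epsilon$ is sufficiently small, then the modified fast collocation scheme is uniquely solvable. That is, there exists $\epsilon_0>0$ (depending on $\alpha$ and on the grid) such that for every $0<\epsilon\le\epsilon_0$, every SOE approximation with tolerance $\epsilon$, and every choice of right-hand sides $f_1,\dots,f_{N-1}\in\mathbb{R}$, there is exactly one vector $(U_0,U_1,\dots,U_N)$ with $U_0=U_N=0$ and $$\mathcal{L}^{(m)}_h[U]_i=f_i,\qquad i=1,2,\dots,N-1 .$$
   Context: Definitions are given on a general grid $a=x_0<\cdots<x_N=b$ with $h_j=x_j-x_{j-1}$ (on the uniform grid all $h_j=h$). $\phi_j$ ($1\le j\le N-1$) is the continuous piecewise linear hat function with $\phi_j(x_k)=\delta_{jk}$, zero outside $[x_{j-1},x_{j+1}]$. For $v=(v_0,\dots,v_N)$ with $v_0=v_N=0$, $\Pi_hv(y)=\sum_{j=1}^{N-1}v_j\phi_j(y)$, $y\in\mathbb{R}$, and $[\Pi_hv]'$ is its piecewise derivative. $C_\alpha=\dfrac{\alpha2^{\alpha-1}\Gamma(\frac{1+\alpha}{2})}{\pi^{1/2}\Gamma(1-\frac{\alpha}{2})}>0$. SOE (sum-of-exponentials) approximation with tolerance $\epsilon$: set $\beta=1+\alpha$ if $\alpha\in(0,1)$ and $\beta=\alpha$ if $\alpha\in[1,2)$; it consists of a positive integer $N_e$ and positive numbers $\lambda_s,\theta_s$ ($1\le s\le N_e$)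 with $\big|x^{-\beta}-\sum_{s=1}^{N_e}\theta_se^{-\lambda_sx}\big|\le\epsilon$ for all $x\in[\Delta x,X]$, where $0<\Delta x\le\min_jh_j$ and $X\ge b-a$. Modified fast collocation operator: for $1\le i\le N-1$, $$\mathcal{L}^{(m)}_h[v]_i=C_\alpha\big(\ell_i[v]+\mathcal{L}^{(m)}_{loc}[v]_i+r_i[v]\big),$$ where, for $\alpha\in(0,1)$, $$\ell_i[v]=\frac{h_i^{-\alpha}}{\alpha}v_i-\sum_{s=1}^{N_e}\theta_s\int_{-\infty}^{x_{i-1}}e^{-\lambda_s(x_i-y)}\Pi_hv(y)\,dy,\qquad r_i[v]=\frac{h_{i+1}^{-\alpha}}{\alpha}v_i-\sum_{s=1}^{N_e}\theta_s\int_{x_{i+1}}^{+\infty}e^{-\lambda_s(y-x_i)}\Pi_hv(y)\,dy,$$ for $\alpha\in[1,2)$, $$\ell_i[v]=\frac{h_i^{-\alpha}}{\alpha}(v_i-v_{i-1})+\frac1\alpha\sum_{s=1}^{N_e}\theta_s\int_{-\infty}^{x_{i-1}}e^{-\lambda_s(x_i-y)}[\Pi_hv]'(y)\,dy,$$ $$r_i[v]=\frac{h_{i+1}^{-\alpha}}{\alpha}(v_i-v_{i+1})-\frac1\alpha\sum_{s=1}^{N_e}\theta_s\int_{x_{i+1}}^{+\infty}e^{-\lambda_s(y-x_i)}[\Pi_hv]'(y)\,dy,$$ and in all cases $$\mathcal{L}^{(m)}_{loc}[v]_i=\Big[-\frac{h_{i+1}}{h_i(h_i+h_{i+1})}v_{i-1}+\frac{h_{i+1}-h_i}{h_ih_{i+1}}v_i+\frac{h_i}{h_{i+1}(h_i+h_{i+1})}v_{i+1}\Big]\eta_i^\alpha,$$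 with $\eta_i^\alpha=\ln h_i-\ln h_{i+1}$ if $\alpha=1$ and $\eta_i^\alpha=\frac{h_i^{1-\alpha}-h_{i+1}^{1-\alpha}}{1-\alpha}$ if $\alpha\ne1$. *)

(* Defs.v *)
From HB Require Import structures.
From mathcomp Require Import all_boot all_order all_algebra.
From mathcomp Require Import all_classical all_reals all_analysis.
Set Implicit Arguments.
Unset Strict Implicit.
Unset Printing Implicit Defensive.
Import Order.TTheory GRing.Theory Num.Theory.
Import numFieldNormedType.Exports.
Local Open Scope classical_set_scope.
Local Open Scope ring_scope.

Section ModifiedFastCollocation.
Variable R : realType.

Local Notation leb := (@lebesgue_measure R).

(* Euler's integral; it is only used at positive arguments. *)
Definition Gamma (s : R) : R :=
  \int[leb]_(t in `]0, +oo[) (t `^ (s - 1) * expR (- t)).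

Definition C_ (alpha : R) : R :=
  alpha * 2 `^ (alpha - 1) * Gamma ((1 + alpha) / 2)
  / (Num.sqrt pi * Gamma (1 - alpha / 2)).

(* A grid x_0 < ... < x_N is a function x : nat -> R of which only the values
   at 0, ..., N matter.  A vector (v_0, ..., v_N) is a row matrix; vcoord v k
   is v_k for k <= N (other k are never used). *)
Definition vcoord (N : nat) (v : 'rV[R]_N.+1) (k : nat) : R := v ord0 (inord k).

Definition mesh (x : nat -> R) (j : nat) : R := x j - x j.-1.

Definition hat (x : nat -> R) (j : nat) (y : R) : R :=
  if x j.-1 <= y <= x j then (y - x j.-1) / mesh x j
  else if x j <= y <= x j.+1 then (x j.+1 - y) / mesh x j.+1
  else 0.

Definition interp (N : nat) (x : nat -> R) (v : 'rV[R]_N.+1) (y : R) : R :=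
  \sum_(1 <= j < N) vcoord v j * hat x j y.

(* The derivative off the grid points.  The interpolant need not be
   differentiable at the grid points, where the value 0 is a convention without
   effect on integrals. *)
Definition interp' (N : nat) (x : nat -> R) (v : 'rV[R]_N.+1) (y : R) : R :=
  if [exists k : 'I_N.+1, y == x k] then 0 else derive1 (interp x v) y.

Definition soe_exponent (alpha : R) : R :=
  if alpha < 1 then 1 + alpha else alpha.

Record SOE_approximation (alpha : R) (N : nat) (x : nat -> R) (eps Dx X : R)
    (Ne : nat) (lambda theta : 'I_Ne -> R) : Prop := {
  soe_size : (0 < Ne)%N ;
  soe_lambda_gt0 : forall s, 0 < lambda s ;
  soe_theta_gt0 : forall s, 0 < theta s ;
  soe_Dx_gt0 : 0 < Dx ;
  soe_Dx_le : forall j, (1 <= j <= N)%N -> Dx <= mesh x j ;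
  soe_X_ge : x N - x 0%N <= X ;
  soe_error : forall t, Dx <= t <= X ->
    `| t `^ (- soe_exponent alpha)
       - \sum_(s < Ne) theta s * expR (- lambda s * t) | <= eps }.

Section Operator.
Variables (alpha : R) (N : nat) (x : nat -> R).
Variables (Ne : nat) (lambda theta : 'I_Ne -> R).
Implicit Types (v : 'rV[R]_N.+1) (i : nat).

Definition ell v i : R :=
  if alpha < 1 then
    mesh x i `^ (- alpha) / alpha * vcoord v i
    - \sum_(s < Ne) theta s *
        \int[leb]_(y in `]-oo, x i.-1])
          (expR (- lambda s * (x i - y)) * interp x v y)
  else
    mesh x i `^ (- alpha) / alpha * (vcoord v i - vcoord v i.-1)
    + alpha^-1 * \sum_(s < Ne) theta s *
        \int[leb]_(y in `]-oo, x i.-1])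
          (expR (- lambda s * (x i - y)) * interp' x v y).

Definition rho v i : R :=
  if alpha < 1 then
    mesh x i.+1 `^ (- alpha) / alpha * vcoord v i
    - \sum_(s < Ne) theta s *
        \int[leb]_(y in `[x i.+1, +oo[)
          (expR (- lambda s * (y - x i)) * interp x v y)
  else
    mesh x i.+1 `^ (- alpha) / alpha * (vcoord v i - vcoord v i.+1)
    - alpha^-1 * \sum_(s < Ne) theta s *
        \int[leb]_(y in `[x i.+1, +oo[)
          (expR (- lambda s * (y - x i)) * interp' x v y).

Definition eta i : R :=
  if alpha == 1 then ln (mesh x i) - ln (mesh x i.+1)
  else (mesh x i `^ (1 - alpha) - mesh x i.+1 `^ (1 - alpha)) / (1 - alpha).

Definition L_loc v i : R :=
  let hl := mesh x i in
  let hr := mesh x i.+1 in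
  (- (hr / (hl * (hl + hr))) * vcoord v i.-1
   + (hr - hl) / (hl * hr) * vcoord v i
   + hl / (hr * (hl + hr)) * vcoord v i.+1) * eta i.

Definition L_h v i : R := C_ alpha * (ell v i + L_loc v i + rho v i).

End Operator.

Definition uniform_grid (a b : R) (N : nat) (i : nat) : R :=
  a + i%:R * ((b - a) / N%:R).

End ModifiedFastCollocation.

(* Main.v *)
Require Import Defs.
From HB Require Import structures.
From mathcomp Require Import all_boot all_order all_algebra.
From mathcomp Require Import all_classical all_reals all_analysis.
From mathcomp Require Import measurable_realfun ring lra zify.
Set Implicit Arguments.
Unset Strict Implicit.
Unset Printing Implicit Defensive.
Import Order.TTheory GRing.Theory Num.Theory.
Import numFieldNormedType.Exports.
Local Open Scope classical_set_scope.
Local Open Scope ring_scope.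

(** On a uniform grid h_i = h_(i+1), so eta_i vanishes and the local part of the
    operator drops out: the scheme is C_alpha (ell_i + rho_i). The argument is a
    discrete maximum principle. If v vanishes at both ends of the grid and has a
    positive maximum at an interior node i, then ell_i[v] > 0 and rho_i[v] > 0.
    Since C_alpha > 0 ([C_gt0]), a solution of the homogeneous scheme has no
    positive entry; the same applies to its opposite, so it is zero
    ([boundary_system_ker]). The scheme with its two boundary conditions is a
    square linear system, hence uniquely solvable ([linear_exists_unique]).

    Write K(t) = sum theta_s exp(- lambda_s t) for the exponential sum and
    T(t) = sum (theta_s / lambda_s) exp(- lambda_s t), so that T' = - K.

    For alpha < 1 the interpolant is at most v_i everywhere and vanishes outside
    [a, b], so the history term of ell_i is at most v_i (T(h) - T(i h))
    ([left_integral_le]). As K(t) <= t^(-1-alpha) + eps, this difference is at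
    most (h^(-alpha) - (i h)^(-alpha)) / alpha + eps (i - 1) h, which a small eps
    keeps below the local coefficient h^(-alpha) / alpha ([tail_gap]).

    For alpha >= 1 the derivative of the interpolant is piecewise constant, and
    alpha ell_i is the sum over 0 <= d < i of (v_(i-d) - v_(i-d-1)) mu_d with
    mu_0 = h^(-alpha) and mu_d, for d >= 1, the mean of K over the cell
    [d h, (d+1) h] ([ell_abel]). Because K is positive and decreasing, so are
    the mu_d for d >= 1, and mu_1 <= mu_0 follows from the error bound on K
    ([cell_weight_decr]). Summation by parts then gives positivity
    ([abel_sum_gt0]). The right-hand terms rho_i have the same form, with
    distances measured to the right. *)

(** * Real analysis and positivity of C_alpha *)

Section Analysis.
Variable R : realType.
Local Notation leb := (@lebesgue_measure R).
Implicit Types (s t x y : R).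

Lemma integral_FTC2 (F f : R -> R) (c d : R) : c <= d ->
  (forall x, c <= x <= d -> is_derive x 1 F (f x)) ->
  (forall x, c <= x <= d -> {for x, continuous f}) ->
  (\int[leb]_(x in `[c, d]) (f x)%:E = (F d - F c)%:E)%E.
Proof.
move=> cd dF cf.
have dF' x : c <= x <= d -> derivable F x 1 by move=> /dF [].
have cF x : c <= x <= d -> {for x, continuous F}.
  by move=> /dF' dx; apply: differentiable_continuous; exact/derivable1_diffP.
move: cd; rewrite le_eqVlt => /predU1P[->|cd].
  by rewrite set_itv1 integral_set1 subrr.
rewrite EFinB; apply: continuous_FTC2 => //.
- apply: continuous_in_subspaceT => x; rewrite inE /= in_itv /=; exact: cf.
- split.
  + by move=> x; rewrite in_itv /= => /andP[cx xd]; apply: dF'; lra.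
  + by apply: cvg_at_right_filter; apply: cF; rewrite lexx ltW.
  + by apply: cvg_at_left_filter; apply: cF; rewrite lexx ltW.
- move=> x; rewrite in_itv /= => /andP[cx xd]; rewrite derive1E.
  by have [_ ->] := dF x ltac:(lra).
Qed.

Lemma Rintegral_FTC2 (F f : R -> R) (c d : R) : c <= d ->
  (forall x, c <= x <= d -> is_derive x 1 F (f x)) ->
  (forall x, c <= x <= d -> {for x, continuous f}) ->
  \int[leb]_(x in `[c, d]) f x = F d - F c.
Proof. by move=> cd dF cf; rewrite /Rintegral (integral_FTC2 cd dF cf). Qed.

Let integrand s t := t `^ (s - 1) * expR (- t).

Let integrand_gt0 s t : 0 < t -> 0 < integrand s t.
Proof. by move=> t0; rewrite mulr_gt0 ?powR_gt0 ?expR_gt0. Qed.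

Let measurable_integrand s (D : set R) : measurable_fun D (integrand s).
Proof.
apply: measurable_funM; first by apply: measurable_funTS; exact: measurable_powR.
by apply: measurable_funTS; apply: measurableT_comp => //; exact: measurable_expR.
Qed.

Lemma continuous_powR p t : 0 < t -> {for t, continuous (fun x => x `^ p)}.
Proof.
move=> t0; apply: differentiable_continuous; apply/derivable1_diffP.
by apply: derivable_powR; rewrite in_itv /= t0.
Qed.

Lemma le_powRN p t t' : 0 < p -> 0 < t -> t <= t' -> t' `^ (- p) <= t `^ (- p).
Proof.
move=> p0 t0 tt'; have t'0 : 0 < t' by lra.
rewrite !powRN lef_pV2 ?posrE ?powR_gt0//.
by apply: ge0_ler_powR; rewrite ?nnegrE// ltW.
Qed.

Lemma lt_powRN p t t' : 0 < p -> 0 < t -> t < t' -> t' `^ (- p) < t `^ (- p).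
Proof.
move=> p0 t0 tt'; have t'0 : 0 < t' by lra.
rewrite !powRN ltf_pV2 ?posrE ?powR_gt0//.
by apply: gt0_ltr_powR; rewrite ?nnegrE// ltW.
Qed.

(** The right-hand side is, up to the factor 64 / s, the derivative of the
    bounded function - 1 / (1 + t^s). It controls the integrand both near 0 and
    at infinity, because (1 + t^s)^2 = O(exp t). *)
Let integrand_le s t : 0 < s <= 2 -> 0 < t ->
  integrand s t <= 64 / s * (s * t `^ (s - 1) / (1 + t `^ s) ^+ 2).
Proof.
move=> /andP[s0 s2] t0; rewrite /integrand.
have -> : 64 / s * (s * t `^ (s - 1) / (1 + t `^ s) ^+ 2) =
   t `^ (s - 1) * (64 / (1 + t `^ s) ^+ 2).
  have ? : 1 + t `^ s != 0 by rewrite gt_eqF// ltr_pwDl// powR_ge0.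
  by field; rewrite (gt_eqF s0) andbT.
rewrite ler_pM2l ?powR_gt0// expRN ler_pdivlMr; last first.
  by rewrite exprn_gt0// ltr_pwDl// powR_ge0.
rewrite mulrC ler_pdivrMr ?expR_gt0//.
have ts : t `^ s <= 1 + t ^+ 2.
  have [t1|t1] := lerP t 1.
    rewrite (@le_trans _ _ 1)// ?lerDl ?sqr_ge0//.
    by rewrite -(powRr0 t); apply: ger_powR; rewrite ?t0 ?t1// ltW.
  rewrite (@le_trans _ _ (t ^+ 2))// ?lerDr//.
  by rewrite -powR_mulrn ?(ltW t0)//; exact: ler_powR (ltW t1) _ _ s2.
(* exp (t / 2) >= 1 + t^2 / 8, and 64 = 8^2 *)
have := @expR_ge1Dxn _ (t / 2) 1 ltac:(lra); rewrite (_ : (2`! = 2)%N)// => h.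
have -> : 64 * expR t = (8 * expR (t / 2)) ^+ 2.
  by rewrite exprMn -expRM_natr; congr (_ * expR _); [ring|field].
rewrite ler_sqr ?nnegrE ?mulr_ge0 ?addr_ge0 ?powR_ge0 ?expR_ge0//.
by move: h; set e := expR _; lra.
Qed.


Let integral_segment_le s x y : 0 < s <= 2 -> 0 < x -> x <= y ->
  (\int[leb]_(t in `[x, y]) (integrand s t)%:E <= (64 / s)%:E)%E.
Proof.
move=> s02 x0 xy; have s0 : 0 < s by case/andP: s02.
have den_gt0 t : 0 < 1 + t `^ s by rewrite ltr_pwDl// powR_ge0.
pose F t := - (64 / s) * (1 + t `^ s)^-1.
pose f t := 64 / s * (s * t `^ (s - 1) / (1 + t `^ s) ^+ 2).
have -> : (64 / s)%:E = (64 / s * 1)%:E by rewrite mulr1.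
have cf t : x <= t <= y -> {for t, continuous f}.
  move=> /andP[xt _]; have t0 : 0 < t by rewrite (lt_le_trans x0).
  apply: cvgM; first exact: cvg_cst.
  apply: cvgM.
    by apply: cvgM; [exact: cvg_cst|exact: continuous_powR].
  apply: cvgV; first by rewrite gt_eqF ?exprn_gt0.
  by apply: cvgM; apply: cvgD; (try exact: cvg_cst); exact: continuous_powR.
have dF t : x <= t <= y -> is_derive t 1 F (f t).
  move=> /andP[xt _]; have t0 : 0 < t by rewrite (lt_le_trans x0).
  have dp := is_derive1_powR s t0.
  have dV : is_derive t 1 (fun t => (1 + t `^ s)^-1)
      (- (1 + t `^ s) ^- 2 *: (0 + s * t `^ (s - 1))).
    by apply: is_deriveV; rewrite gt_eqF.
  apply: (is_derive_eq (is_deriveZ (- (64 / s)) dV)).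
  by rewrite /f /GRing.scale /=; field; rewrite !gt_eqF.
apply: (@le_trans _ _ (\int[leb]_(t in `[x, y]) (f t)%:E)%E).
  apply: ge0_le_integral => //.
  - move=> t /=; rewrite in_itv /= => /andP[xt _].
    by rewrite lee_fin ltW// integrand_gt0// (lt_le_trans x0).
  - by apply/measurable_EFinP; apply: measurable_integrand.
  - apply/measurable_EFinP; apply: subspace_continuous_measurable_fun => //.
    by apply: continuous_in_subspaceT => t; rewrite inE /= in_itv /=; exact: cf.
  - move=> t /=; rewrite in_itv /= => /andP[xt _].
    by rewrite lee_fin integrand_le// (lt_le_trans x0).
rewrite (integral_FTC2 xy dF cf) lee_fin /F !mulNr opprK addrC -mulrBr.
rewrite ler_pM2l ?divr_gt0//.
have := den_gt0 y; rewrite -invr_gt0 => /ltW ?.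
rewrite (@le_trans _ _ (1 + x `^ s)^-1) ?gerBl//.
by rewrite invf_le1// lerDl powR_ge0.
Qed.

(** As Gamma reads a real number off an extended integral, and gives 0 when the
    integral diverges, positivity requires the integral to be finite as well:
    the bound over segments passes to the limit along [1 / (n+1), n+1]. A lower
    bound is the minimum of the integrand on [1, 2]. *)
Lemma Gamma_gt0 s : 0 < s <= 2 -> 0 < Gamma s.
Proof.
move=> s02; have s0 : 0 < s by case/andP: s02.
pose D n : set R := `[n.+1%:R^-1, n.+1%:R]%classic.
have Dpos n t : D n t -> 0 < t.
  by rewrite /D /= in_itv /= => /andP[+ _]; apply: lt_le_trans; rewrite invr_gt0.
have DU : `]0, +oo[%classic = \bigcup_n D n.
  apply/seteqP; split=> [t|t [n _ /Dpos]]; rewrite /= in_itv /= andbT// => t0.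
  pose n := Num.truncn (t + t^-1).
  have tn : t + t^-1 < n.+1%:R by apply: truncnS_gt.
  exists n => //; rewrite /D /= in_itv /=; have t10 : 0 < t^-1 by rewrite invr_gt0.
  by rewrite invf_ple ?posrE//; apply/andP; split; lra.
have nndD : nondecreasing_seq D.
  move=> m n mn; rewrite subsetEset => t; rewrite /D /= !in_itv /= => /andP[mt tm].
  have mn' : m.+1%:R <= n.+1%:R :> R by rewrite ler_nat.
  by rewrite (le_trans _ mt) ?(le_trans tm)// lef_pV2 ?posrE.
have ub : (\int[leb]_(t in `]0%R, +oo[) (integrand s t)%:E <= (64 / s)%:E)%E.
  rewrite DU.
  have cvgD := @ge0_nondecreasing_set_cvg_integral
    _ (measurableTypeR R) R D (EFin \o integrand s) leb nndD.
  rewrite -(cvg_lim _ (cvgD _ _ _))//; last 3 first.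
  - by move=> n; exact: measurable_itv.
  - by move=> n; apply/measurable_EFinP; apply: measurable_integrand.
  - by move=> n t /Dpos t0; rewrite lee_fin ltW// integrand_gt0.
  apply: lime_le.
    apply: cvgP; apply: cvgD.
    - by move=> n; exact: measurable_itv.
    - by move=> n; apply/measurable_EFinP; apply: measurable_integrand.
    - by move=> n t /Dpos t0; rewrite lee_fin ltW// integrand_gt0.
  apply: nearW => n; apply: integral_segment_le => //.
  by rewrite (@le_trans _ _ 1) ?invf_le1 ?ler1n.
have [c c12 minc] : exists2 c : R, c \in `[1, 2] &
    forall t, t \in `[1, 2] -> integrand s c <= integrand s t.
  apply: EVT_min; first by rewrite ler1n.
  apply: continuous_in_subspaceT => t; rewrite inE /= in_itv /= => /andP[t1 _].
  apply: cvgM; first by apply: continuous_powR; lra.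
  by apply: continuous_comp; [exact: opp_continuous|exact: continuous_expR].
have c0 : 0 < integrand s c.
  by apply: integrand_gt0; move: c12; rewrite in_itv /=; lra.
have lb : ((integrand s c)%:E <= \int[leb]_(t in `]0%R, +oo[) (integrand s t)%:E)%E.
  apply: (@le_trans _ _ (\int[leb]_(t in `[1%R, 2%R]) (integrand s t)%:E)%E).
    have -> : (integrand s c)%:E = (\int[leb]_(t in `[1%R, 2%R]) (integrand s c)%:E)%E.
      rewrite integral_cst//= lebesgue_measure_itv /= lte_fin ltr1n -EFinB -EFinM.
      by congr EFin; ring.
    apply: ge0_le_integral => //.
    - by move=> t _; rewrite lee_fin ltW.
    - apply/measurable_EFinP; apply: measurable_integrand.
  apply: ge0_subset_integral => //.
  - apply/measurable_EFinP; apply: measurable_integrand.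
  - move=> t; rewrite /= in_itv /= andbT => t0.
    by rewrite lee_fin ltW// integrand_gt0.
  - by move=> t; rewrite /= !in_itv /= andbT; lra.
rewrite /Gamma /Rintegral fine_gt0//; apply/andP; split.
  by apply: lt_le_trans lb; rewrite lte_fin.
by apply: le_lt_trans ub _; rewrite ltry.
Qed.

Lemma C_gt0 (alpha : R) : 0 < alpha < 2 -> 0 < C_ alpha.
Proof.
move=> a02; rewrite /C_ divr_gt0 ?mulr_gt0 ?powR_gt0 ?sqrtr_gt0 ?pi_gt0//;
  by [lra|apply: Gamma_gt0; lra].
Qed.

End Analysis.

(** * The uniform grid and the interpolant *)

Section UniformGrid.
Variables (R : realType) (a b : R) (N : nat).
Hypotheses (hab : a < b) (hN : (0 < N)%N).
Local Notation leb := (@lebesgue_measure R).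
Local Notation h := ((b - a) / N%:R).
Local Notation x := (uniform_grid a b N).
Implicit Types (y : R) (i j k : nat) (u v : 'rV[R]_N.+1).

Lemma step_gt0 : 0 < h.
Proof. by rewrite divr_gt0 ?subr_gt0 ?ltr0n. Qed.

Lemma grid0 : x 0 = a.
Proof. by rewrite /uniform_grid mul0r addr0. Qed.

Lemma gridN : x N = b.
Proof.
by rewrite /uniform_grid mulrC divfK ?pnatr_eq0 -?lt0n// addrC subrK.
Qed.

Lemma gridS k : x k.+1 = x k + h.
Proof. by rewrite /uniform_grid -natr1; ring. Qed.

Lemma gridB k j : (k <= j)%N -> x j - x k = (j - k)%:R * h.
Proof. by move=> kj; rewrite /uniform_grid natrB//; ring. Qed.

Lemma ler_grid k j : (x k <= x j) = (k <= j)%N.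
Proof. by rewrite lerD2l ler_pM2r ?step_gt0// ler_nat. Qed.

Lemma ltr_grid k j : (x k < x j) = (k < j)%N.
Proof. by rewrite ltNge ler_grid ltnNge. Qed.

Lemma mesh_grid j : (0 < j)%N -> mesh x j = h.
Proof. by case: j => // j _; rewrite /mesh /= gridS addrC addKr. Qed.

(** This closed form gives the support, the bounds and the measurability of the
    hat function without case distinction. *)
Lemma hat_grid j y : (0 < j)%N -> hat x j y = Num.max 0 (1 - `|y - x j| / h).
Proof.
move=> j0; have h0 := step_gt0; rewrite /hat !mesh_grid// gridS.
have -> : x j.-1 = x j - h by case: j j0 => // j _; rewrite gridS addrK.
have hV : h / h = 1 by rewrite divff// gt_eqF.
case: ifPn => [/andP[l1 l2]|n1].
  rewrite ler0_norm ?subr_le0//.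
  rewrite (_ : 1 - _ = (y - (x j - h)) / h); last by rewrite -{1}hV; ring.
  by rewrite max_r// divr_ge0 ?subr_ge0// ltW.
case: ifPn => [/andP[l1 l2]|n2].
  rewrite ger0_norm ?subr_ge0//.
  rewrite (_ : 1 - _ = (x j + h - y) / h); last by rewrite -{1}hV; ring.
  by rewrite max_r// divr_ge0 ?subr_ge0// ltW.
rewrite max_l// subr_le0 ler_pdivlMr// mul1r.
move: n1 n2; rewrite !negb_and -!ltNge => n1 n2.
by case: (ler0P (y - x j)) => ?; case/orP: n1 => ?; case/orP: n2 => ?; lra.
Qed.

Lemma hat_ge0 j y : (0 < j)%N -> 0 <= hat x j y.
Proof. by move=> j0; rewrite hat_grid// le_max lexx. Qed.

Lemma hat_le1 j y : (0 < j)%N -> hat x j y <= 1.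
Proof.
move=> j0; rewrite hat_grid// ge_max ler01 gerBl divr_ge0 ?normr_ge0//.
by rewrite ltW ?step_gt0.
Qed.

Lemma hat_eq0 j y : (0 < j)%N -> h <= `|y - x j| -> hat x j y = 0.
Proof.
move=> j0 hy; rewrite hat_grid// max_l//.
by rewrite subr_le0 ler_pdivlMr ?step_gt0// mul1r.
Qed.

Lemma measurable_hat j : (0 < j)%N -> measurable_fun [set: R] (hat x j).
Proof.
move=> j0; rewrite (_ : hat x j = fun y => Num.max 0 (1 - `|y - x j| / h)).
  apply: measurable_maxr => //; apply: measurable_funB => //.
  apply: measurable_funM => //; apply: measurableT_comp => //.
  exact: measurable_funB.
by apply/funext => y; exact: hat_grid.
Qed.

(** The interpolant sums over interior nodes only, so on the first and last cells
    it interpolates 0 at the end points whatever the boundary entries of v are. *)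
Definition interior_part v k : R := if (0 < k < N)%N then vcoord v k else 0.

Lemma interior_partD c u v k :
  interior_part (c *: u + v) k = c * interior_part u k + interior_part v k.
Proof.
by rewrite /interior_part /vcoord; case: ifP => _; rewrite ?mxE ?mulr0 ?addr0.
Qed.

Lemma interpE v y : interp x v y = \sum_(0 <= j < N.+1) interior_part v j * hat x j y.
Proof.
rewrite big_nat_recr//= {2}/interior_part ltnn andbF mul0r addr0.
rewrite big_ltn// {1}/interior_part mul0r add0r.
by apply: eq_big_nat => j jN; rewrite /interior_part jN.
Qed.


Lemma interp_eq0 v y : y <= a \/ b <= y -> interp x v y = 0.
Proof.
move=> yab; rewrite /interp big1_seq// => j; rewrite mem_index_iota => /= jN.
have [j0 jN'] := andP jN; have h0 := step_gt0.
rewrite hat_eq0 ?mulr0//.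
have xj : x 1 <= x j <= x N.-1 by rewrite !ler_grid; lia.
have x1 := gridS 0; have xN := gridS N.-1.
rewrite prednK// gridN in xN; rewrite grid0 in x1.
by case: yab => ?; [rewrite ler0_norm|rewrite ger0_norm]; lra.
Qed.

Lemma interp_segment v k y : (k < N)%N -> x k <= y <= x k.+1 ->
  interp x v y =
  interior_part v k * ((x k.+1 - y) / h) + interior_part v k.+1 * ((y - x k) / h).
Proof.
move=> kN /andP[ky yk]; have h0 := step_gt0; have xk := gridS k.
have kN1 : (k.+1 < N.+1)%N by [].
rewrite interpE (big_cat_nat (n := k))//=; last by lia.
rewrite big_nat_cond big1 ?add0r; last first.
  move=> [|j]; rewrite andbT => /andP[_ jk].
    by rewrite /interior_part mul0r.
  rewrite hat_eq0 ?mulr0// ger0_norm ?subr_ge0.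
    by have := gridB jk; have := ler_grid j.+2 k; rewrite jk gridS; lra.
  by rewrite (le_trans _ ky)// ler_grid ltnW.
rewrite big_ltn//; last by lia.
rewrite big_ltn// [X in _ + (_ + X)]big_nat_cond [X in _ + (_ + X)]big1 ?addr0; last first.
  move=> [|j]; rewrite andbT// => /andP[kj jN].
  rewrite hat_eq0 ?mulr0// ler0_norm ?subr_le0.
    have : x k.+2 <= x j.+1 by rewrite ler_grid.
    by rewrite (gridS k.+1); lra.
  by rewrite (le_trans yk)// ler_grid; lia.
have hV : h / h = 1 by rewrite divff// gt_eqF.
congr (_ + _).
  case: k kN ky yk xk kN1 => [|k] kN ky yk xk kN1.
    by rewrite /interior_part !mul0r.
  rewrite hat_grid// ger0_norm ?subr_ge0// max_r.
    by congr (_ * _); rewrite -{1}hV xk; ring.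
  by rewrite subr_ge0 ler_pdivrMr// mul1r; lra.
rewrite hat_grid// ler0_norm ?subr_le0// max_r.
  by congr (_ * _); rewrite -{1}hV xk; ring.
by rewrite subr_ge0 ler_pdivrMr// mul1r; lra.
Qed.

Lemma grid_locate y : a <= y < b -> exists2 k, (k < N)%N & x k <= y < x k.+1.
Proof.
move=> /andP[ay yb]; have h0 := step_gt0.
have q0 : 0 <= (y - a) / h by rewrite divr_ge0 ?subr_ge0// ltW.
have /andP[kq qk] := Num.Theory.truncn_itv q0.
set k := Num.truncn _ in kq qk.
rewrite ler_pdivlMr// in kq; rewrite ltr_pdivrMr// in qk.
have xk : x k <= y < x k.+1 by rewrite /uniform_grid; lra.
exists k => //; rewrite -ltr_grid gridN.
by case/andP: xk => xk _; rewrite (le_lt_trans xk).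
Qed.

(** On each cell the interpolant is a convex combination of two nodal values,
    and outside the grid it is 0. *)
Lemma interp_le v M y : 0 <= M -> (forall k, interior_part v k <= M) ->
  interp x v y <= M.
Proof.
move=> M0 vM; have h0 := step_gt0.
have [ya|ay] := leP y a; first by rewrite interp_eq0//; left.
have [yb|yb] := leP b y; first by rewrite interp_eq0//; right.
have [|k kN /andP[ky yk]] := @grid_locate y; first by rewrite ltW.
rewrite (@interp_segment _ k)//; last by rewrite ky ltW.
have xk := gridS k.
rewrite [leRHS](_ : M = M * ((x k.+1 - y) / h) + M * ((y - x k) / h)); last first.
  by rewrite xk; move: h h0 (x k) => H H0 X; field; rewrite gt_eqF.
rewrite lerD ?ler_wpM2r ?divr_ge0 ?subr_ge0//; by rewrite ltW.
Qed.

Lemma interp_bounded v y : `|interp x v y| <= \sum_(1 <= j < N) `|vcoord v j|.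
Proof.
rewrite (le_trans (ler_norm_sum _ _ _))//; rewrite big_nat_cond [leRHS]big_nat_cond.
apply: ler_sum => j /andP[/andP[j0 _] _].
by rewrite normrM (ger0_norm (hat_ge0 _ _))// ler_piMr// hat_le1.
Qed.

Lemma measurable_interp v : measurable_fun [set: R] (interp x v).
Proof.
rewrite (_ : interp x v = fun y =>
    \sum_(j <- index_iota 1 N) vcoord v j * (if (0 < j)%N then hat x j y else 0)).
  apply: measurable_sum => j; apply: measurable_funM => //.
  by case: ltnP => // j0; exact: measurable_hat.
apply/funext => y; rewrite /interp big_nat_cond [RHS]big_nat_cond.
by apply: eq_bigr => j /andP[/andP[-> _] _].
Qed.

Lemma interp_linear c u v y :
  interp x (c *: u + v) y = c * interp x u y + interp x v y.
Proof.
rewrite !interpE mulr_sumr -big_split /=; apply: eq_bigr => j _.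
by rewrite interior_partD; ring.
Qed.

Definition slope v k : R := (interior_part v k.+1 - interior_part v k) / h.

Lemma interp'_segment v k y : (k < N)%N -> x k < y < x k.+1 ->
  interp' x v y = slope v k.
Proof.
move=> kN /andP[ky yk]; rewrite /interp' ifF; last first.
  apply/existsP => -[m /eqP ym]; move: ky yk; rewrite ym !ltr_grid; lia.
rewrite derive1E.
have -> : 'D_1 (interp x v) y =
    'D_1 (fun z => interior_part v k + slope v k * (z - x k)) y.
  apply: near_eq_derive; near=> z.
  rewrite (@interp_segment _ k)//; last first.
    have : z \in `]x k, x k.+1[.
      by near: z; apply: near_in_itvoo; rewrite in_itv /= ky.
    by rewrite in_itv /= => /andP[/ltW -> /ltW ->].
  by rewrite /slope gridS; move: h step_gt0 (x k) => H H0 X; field; rewrite gt_eqF.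
have d : is_derive y 1 (cst (interior_part v k) + slope v k \*: (id - cst (x k)))
   (0 + slope v k *: (1 - 0)).
  by apply: is_deriveD; apply: is_deriveZ; apply: is_deriveB.
have -> := derive_val (is_derive := d); by rewrite subr0 add0r /GRing.scale /= mulr1.
Unshelve. all: by end_near. Qed.

Lemma interp'_eq0 v y : y <= a \/ b <= y -> interp' x v y = 0.
Proof.
move=> yab; rewrite /interp'; case: ifPn => // /existsPn yx.
have {yab} yab : y < a \/ b < y.
  have := yx ord0; rewrite /= grid0 => ya.
  have := yx ord_max; rewrite /= gridN => yb.
  by case: yab => l; [left; rewrite lt_neqAle ya|right; rewrite lt_neqAle eq_sym yb].
rewrite derive1E; have -> : 'D_1 (interp x v) y = 'D_1 (cst (0 : R)) y.
  apply: near_eq_derive; case: yab => ?; near=> z; apply: interp_eq0.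
    have : z \in `]-oo, a[ by near: z; apply: near_in_itvNyo; rewrite in_itv.
    by rewrite in_itv /= => /ltW; left.
  have : z \in `]b, +oo[ by near: z; apply: near_in_itvoy; rewrite in_itv /= andbT.
  by rewrite in_itv /= andbT => /ltW; right.
exact: derive_cst.
Unshelve. all: by end_near. Qed.

Lemma interp'_grid v m : (m <= N)%N -> interp' x v (x m) = 0.
Proof.
move=> mN; rewrite /interp'; case: existsP => // -[].
by exists (Ordinal (mN : (m < N.+1)%N)).
Qed.

(** The cells are open, so at a grid point the right-hand side is 0, in agreement
    with the convention there; the identity needs no almost everywhere. *)
Lemma interp'E v y :
  interp' x v y = \sum_(k < N) slope v k * \1_(`]x k, x k.+1[%classic) y.
Proof.
have zero k : ~ (x k < y < x k.+1) -> slope v k * \1_(`]x k, x k.+1[%classic) y = 0.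
  by move=> ky; rewrite indicE memNset ?mulr0//= in_itv.
have [yab|/not_orP[/negP ya /negP yb]] := pselect (y <= a \/ b <= y).
  rewrite interp'_eq0// big1// => k _; apply: zero => /andP[ky yk].
  have : x 0 <= x k by rewrite ler_grid.
  have : x k.+1 <= x N by rewrite ler_grid.
  by rewrite grid0 gridN; case: yab; lra.
have [|k kN /andP[]] := @grid_locate y; first by lra.
rewrite le_eqVlt => /predU1P[ky _|ky yk].
  rewrite big1 => [|j _]; last by apply: zero; rewrite -ky !ltr_grid; lia.
  by rewrite -ky interp'_grid// ltnW.
rewrite (@interp'_segment _ k) ?ky// (bigD1 (Ordinal kN))//= big1 ?addr0.
  by rewrite indicE mem_set ?mulr1//= in_itv /= ky.
move=> j /eqP jk; apply: zero => /andP[jy yj]; apply: jk; apply/val_inj => /=.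
have : x j < x k.+1 by lra.
have : x k < x j.+1 by lra.
by rewrite !ltr_grid; lia.
Qed.

Lemma interp'_linear c u v y :
  interp' x (c *: u + v) y = c * interp' x u y + interp' x v y.
Proof.
rewrite !interp'E mulr_sumr -big_split /=; apply: eq_bigr => j _.
by rewrite /slope !interior_partD; ring.
Qed.

Lemma interp'_bounded v y : `|interp' x v y| <= \sum_(k < N) `|slope v k|.
Proof.
rewrite interp'E (le_trans (ler_norm_sum _ _ _))//; apply: ler_sum => k _.
by rewrite normrM ler_piMr// indicE; case: (_ \in _); rewrite ?normr1 ?normr0.
Qed.

Lemma measurable_interp' v : measurable_fun [set: R] (interp' x v).
Proof.
rewrite (_ : interp' x v = fun y =>
    \sum_(k < N) slope v k * \1_(`]x k, x k.+1[%classic) y).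
  by apply: measurable_sum => k; apply: measurable_funM.
by apply/funext => y; exact: interp'E.
Qed.

End UniformGrid.

(** * Integration against exponentials *)

Section Exponentials.
Variable R : realType.
Local Notation leb := (@lebesgue_measure R).
Implicit Types (y z c d : R) (e f g : R -> R).

(** Domination on the compact support; this covers every integral of the scheme,
    over unbounded half-lines too. *)
Lemma integrable_mul_supported (a b B : R) (D : set (measurableTypeR R)) e g :
  measurable D -> continuous e -> measurable_fun [set: R] g ->
  (forall y, `|g y| <= B) -> (forall y, y <= a \/ b <= y -> g y = 0) ->
  leb.-integrable D (EFin \o (fun y => e y * g y)).
Proof.
move=> mD ce mg gB g0.
apply: (integrableS measurableT mD); first exact: subsetT.
have -> : (fun y => e y * g y) = (fun y => e y * g y) \_ `[a, b].
  apply/funext => y; rewrite patchE; case: ifPn => // /negP yab.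
  rewrite g0 ?mulr0//; apply: contra_notP yab => /not_orP[/negP ? /negP ?].
  by rewrite inE /= in_itv /=; apply/andP; split; lra.
have mab : measurable (`[a, b]%classic : set (measurableTypeR R)).
  exact: measurable_itv.
rewrite -restrict_EFin; apply: (integrable_mkcond _ mab).1.

apply: (@le_integrable _ (measurableTypeR R) R leb _ mab
  (EFin \o (fun y => e y * g y)) (EFin \o (fun y => B * e y))) => //.
- apply/measurable_EFinP; apply: measurable_funM; last exact: measurable_funTS.
  by apply: measurable_funTS; apply: continuous_measurable_fun.
- move=> y _ /=; rewrite lee_fin !normrM mulrC ler_wpM2r//.
  by rewrite (le_trans (gB y))// ler_norm.
- rewrite (_ : EFin \o _ = (fun y => B%:E * (EFin \o e) y)%E)//.
  apply: integrableZl => //; apply: continuous_compact_integrable.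
    exact: segment_compact.
  exact: continuous_subspaceT.
Qed.

Lemma Rintegral_supported (D S : set (measurableTypeR R)) f :
  (forall y, ~ S y -> f y = 0) ->
  \int[leb]_(y in D) f y = \int[leb]_(y in D `&` S) f y.
Proof.
move=> f0; rewrite Rintegral_mkcondr; apply: eq_Rintegral => y _.
by rewrite patchE; case: ifPn => // /negP yS; rewrite f0// => /mem_set.
Qed.

Lemma Rintegral_sum (D : set (measurableTypeR R)) n (F : 'I_n -> R -> R) :
  measurable D -> (forall k, leb.-integrable D (EFin \o F k)) ->
  \int[leb]_(y in D) (\sum_(k < n) F k y) =
  \sum_(k < n) \int[leb]_(y in D) F k y.
Proof.
move=> mD iF; rewrite /Rintegral.
under eq_integral do rewrite -sumEFin.
rewrite integral_sum// -sum_fine// => k _.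
exact: (integrable_fin_num mD (iF k)).
Qed.

(** Both kernels exp(- lambda (x_i - y)) and exp(- lambda (y - x_i)) are of the
    form exp(p y + q), with p of either sign. *)
Lemma is_derive_expR_affine (p q y : R) :
  is_derive y 1 (fun y => expR (p * y + q)) (p * expR (p * y + q)).
Proof.
have d : is_derive y 1 (p \*: (@id R) + cst q) (p *: 1 + 0).
  by apply: is_deriveD; apply: is_deriveZ.
apply: (is_derive_eq (is_derive1_comp (is_derive_expR _) d)).
by rewrite addr0 /GRing.scale /= mulr1 mulrC.
Qed.

Lemma continuous_expR_affine (p q : R) : continuous (fun y => expR (p * y + q)).
Proof.
move=> y; apply: differentiable_continuous; apply/derivable1_diffP.
by have [] := is_derive_expR_affine p q y.
Qed.

Lemma Rintegral_expR_affine (p q c d : R) : p != 0 -> c <= d ->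
  \int[leb]_(y in `[c, d]) expR (p * y + q) =
  (expR (p * d + q) - expR (p * c + q)) / p.
Proof.
move=> p0 cd.
pose F := p^-1 \*: (fun y => expR (p * y + q)).
transitivity (F d - F c); last by rewrite /F /= /GRing.scale /=; ring.
apply: Rintegral_FTC2 => // y _; last exact: continuous_expR_affine.
apply: (is_derive_eq (is_deriveZ p^-1 (is_derive_expR_affine p q y))).
by rewrite /GRing.scale /= mulKf.
Qed.

End Exponentials.

(** * The exponential sum acting on the interpolant *)

Section Tails.
Variables (R : realType) (a b : R) (N : nat).
Hypotheses (hab : a < b) (hN : (0 < N)%N).
Variables (Ne : nat) (lambda theta : 'I_Ne -> R).
Hypotheses (lambda_gt0 : forall s, 0 < lambda s) (theta_gt0 : forall s, 0 < theta s).
Local Notation leb := (@lebesgue_measure R).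
Local Notation h := ((b - a) / N%:R).
Local Notation x := (uniform_grid a b N).
Implicit Types (y : R) (i j k : nat) (u v : 'rV[R]_N.+1).

(** Integral of the exponential sum over the half-line beyond t; integrals of
    the sum over segments are differences of tails. *)
Definition tail t : R := \sum_(s < Ne) theta s * (expR (- lambda s * t) / lambda s).

Let leftE i s y : expR (- lambda s * (x i - y)) =
  expR (lambda s * y + - lambda s * x i).
Proof. by congr expR; ring. Qed.

Let rightE i s y : expR (- lambda s * (y - x i)) =
  expR (- lambda s * y + lambda s * x i).
Proof. by congr expR; ring. Qed.

Lemma Rintegral_left_kernel i s c d : c <= d ->
  \int[leb]_(y in `[c, d]) expR (- lambda s * (x i - y)) =
  expR (- lambda s * (x i - d)) / lambda s - expR (- lambda s * (x i - c)) / lambda s.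
Proof.
move=> cd; under eq_Rintegral do rewrite leftE.
by rewrite Rintegral_expR_affine ?gt_eqF// -!leftE mulrBl.
Qed.

Lemma Rintegral_right_kernel i s c d : c <= d ->
  \int[leb]_(y in `[c, d]) expR (- lambda s * (y - x i)) =
  expR (- lambda s * (c - x i)) / lambda s - expR (- lambda s * (d - x i)) / lambda s.
Proof.
move=> cd; under eq_Rintegral do rewrite rightE.
rewrite Rintegral_expR_affine ?oppr_eq0 ?gt_eqF// -!rightE invrN mulrN -mulNr opprB.
by rewrite mulrBl.
Qed.

Lemma continuous_left_kernel i s : continuous (fun y => expR (- lambda s * (x i - y))).
Proof.
rewrite (_ : (fun y => _) = (fun y => expR (lambda s * y + - lambda s * x i))).
  exact: continuous_expR_affine.
by apply/funext => y; exact: leftE.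
Qed.

Lemma continuous_right_kernel i s : continuous (fun y => expR (- lambda s * (y - x i))).
Proof.
rewrite (_ : (fun y => _) = (fun y => expR (- lambda s * y + lambda s * x i))).
  exact: continuous_expR_affine.
by apply/funext => y; exact: rightE.
Qed.

Lemma integrable_interp (e : R -> R) (D : set (measurableTypeR R)) v :
  measurable D -> continuous e ->
  leb.-integrable D (EFin \o (fun y => e y * interp x v y)).
Proof.
move=> mD ce; apply: (integrable_mul_supported (a := a) (b := b)) => //.
- exact: measurable_interp.
- by move=> y; exact: interp_bounded.
- by move=> y; exact: interp_eq0.
Qed.

Lemma integrable_interp' (e : R -> R) (D : set (measurableTypeR R)) v :
  measurable D -> continuous e ->
  leb.-integrable D (EFin \o (fun y => e y * interp' x v y)).
Proof.
move=> mD ce; apply: (integrable_mul_supported (a := a) (b := b)) => //.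
- exact: measurable_interp'.
- by move=> y; exact: interp'_bounded.
- by move=> y; exact: interp'_eq0.
Qed.

Lemma Rintegral_interp_linear (e : R -> R) (D : set (measurableTypeR R)) c u v :
  measurable D -> continuous e ->
  \int[leb]_(y in D) (e y * interp x (c *: u + v) y) =
  c * \int[leb]_(y in D) (e y * interp x u y) +
  \int[leb]_(y in D) (e y * interp x v y).
Proof.
move=> mD ce; rewrite -RintegralZl//; last exact: integrable_interp.
rewrite -RintegralD//; last 2 first.
- have := integrableZl mD c (integrable_interp u mD ce); exact.
- exact: integrable_interp.
by apply: eq_Rintegral => y _; rewrite interp_linear//; ring.
Qed.

Lemma Rintegral_interp'_linear (e : R -> R) (D : set (measurableTypeR R)) c u v :
  measurable D -> continuous e ->
  \int[leb]_(y in D) (e y * interp' x (c *: u + v) y) =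
  c * \int[leb]_(y in D) (e y * interp' x u y) +
  \int[leb]_(y in D) (e y * interp' x v y).
Proof.
move=> mD ce; rewrite -RintegralZl//; last exact: integrable_interp'.
rewrite -RintegralD//; last 2 first.
- have := integrableZl mD c (integrable_interp' u mD ce); exact.
- exact: integrable_interp'.
by apply: eq_Rintegral => y _; rewrite interp'_linear//; ring.
Qed.

Let sum_theta_linear (I : 'rV[R]_N.+1 -> 'I_Ne -> R) c u v :
  (forall s, I (c *: u + v) s = c * I u s + I v s) ->
  \sum_(s < Ne) theta s * I (c *: u + v) s =
  c * (\sum_(s < Ne) theta s * I u s) + \sum_(s < Ne) theta s * I v s.
Proof.
move=> IE; rewrite mulr_sumr -big_split /=; apply: eq_bigr => s _.
by rewrite IE; ring.
Qed.

Let vcoord_linear c u v k : vcoord (c *: u + v) k = c * vcoord u k + vcoord v k.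
Proof. by rewrite /vcoord !mxE. Qed.

Lemma ell_linear alpha c u v i :
  ell alpha x lambda theta (c *: u + v) i =
  c * ell alpha x lambda theta u i + ell alpha x lambda theta v i.
Proof.
pose I (w : R -> R) s := \int[leb]_(y in `]-oo, x i.-1]) (expR (- lambda s * (x i - y)) * w y).
have linear_interp := sum_theta_linear (I := fun v => I (interp x v)) (fun s =>
  Rintegral_interp_linear c u v (measurable_itv _) (@continuous_left_kernel i s)).
have linear_interp' := sum_theta_linear (I := fun v => I (interp' x v)) (fun s =>
  Rintegral_interp'_linear c u v (measurable_itv _) (@continuous_left_kernel i s)).
(* Both branches are instances of these identities; applying them separates the
   nodal values from the integrals. *)
have combine1 (m : R) p pu pv S Su Sv : p = c * pu + pv -> S = c * Su + Sv ->
    m * p - S = c * (m * pu - Su) + (m * pv - Sv) :> R.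
  by move=> -> ->; ring.
have combine2 m (k : R) p pu pv q qu qv S Su Sv :
    p = c * pu + pv -> q = c * qu + qv -> S = c * Su + Sv ->
    m * (p - q) + k * S =
    c * (m * (pu - qu) + k * Su) + (m * (pv - qv) + k * Sv) :> R.
  by move=> -> -> ->; ring.
rewrite /ell; case: (alpha < 1).
  by apply: combine1; [exact: vcoord_linear|exact: linear_interp].
by apply: combine2; [exact: vcoord_linear..|exact: linear_interp'].
Qed.

Lemma rho_linear alpha c u v i :
  rho alpha x lambda theta (c *: u + v) i =
  c * rho alpha x lambda theta u i + rho alpha x lambda theta v i.
Proof.
pose I (w : R -> R) s := \int[leb]_(y in `[x i.+1, +oo[) (expR (- lambda s * (y - x i)) * w y).
have linear_interp := sum_theta_linear (I := fun v => I (interp x v)) (fun s =>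
  Rintegral_interp_linear c u v (measurable_itv _) (@continuous_right_kernel i s)).
have linear_interp' := sum_theta_linear (I := fun v => I (interp' x v)) (fun s =>
  Rintegral_interp'_linear c u v (measurable_itv _) (@continuous_right_kernel i s)).
(* Both branches are instances of these identities; applying them separates the
   nodal values from the integrals. *)
have combine1 (m : R) p pu pv S Su Sv : p = c * pu + pv -> S = c * Su + Sv ->
    m * p - S = c * (m * pu - Su) + (m * pv - Sv) :> R.
  by move=> -> ->; ring.
have combine2 m (k : R) p pu pv q qu qv S Su Sv :
    p = c * pu + pv -> q = c * qu + qv -> S = c * Su + Sv ->
    m * (p - q) - k * S =
    c * (m * (pu - qu) - k * Su) + (m * (pv - qv) - k * Sv) :> R.
  by move=> -> -> ->; ring.
rewrite /rho; case: (alpha < 1).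
  by apply: combine1; [exact: vcoord_linear|exact: linear_interp].
by apply: combine2; [exact: vcoord_linear..|exact: linear_interp'].
Qed.

(** The interpolant is at most M on the part of D inside the grid and 0 outside. *)
Lemma Rintegral_interp_le (e : R -> R) (D : set (measurableTypeR R)) v M c d :
  continuous e -> (forall y, 0 <= e y) ->
  0 <= M -> (forall k, interior_part v k <= M) ->
  D `&` `[a, b] = `[c, d]%classic -> measurable D ->
  \int[leb]_(y in D) (e y * interp x v y) <= M * \int[leb]_(y in `[c, d]) e y.
Proof.
move=> ce e0 M0 vM Dcd mD.
rewrite (@Rintegral_supported _ D `[a, b]); last first.
  move=> y /= /negP; rewrite in_itv /= negb_and -!ltNge => yab.
  by rewrite interp_eq0 ?mulr0//; case/orP: yab => /ltW; [left|right].
have ie : leb.-integrable `[c, d] (EFin \o e).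
  apply: continuous_compact_integrable; first exact: segment_compact.
  exact: continuous_subspaceT.
rewrite Dcd -RintegralZl//.
apply: le_Rintegral => //.
- by apply: integrable_interp => //; exact: measurable_itv.
- have mcd : measurable (`[c, d]%classic : set (measurableTypeR R)).
    exact: measurable_itv.
  exact: (integrableZl mcd M ie).
- by move=> y _; rewrite mulrC ler_wpM2r// interp_le.
Qed.

Lemma left_integral_le v i M : (0 < i < N)%N -> 0 <= M ->
  (forall k, interior_part v k <= M) ->
  \sum_(s < Ne) theta s * \int[leb]_(y in `]-oo, x i.-1])
     (expR (- lambda s * (x i - y)) * interp x v y)
  <= M * (tail h - tail (i%:R * h)).
Proof.
move=> /andP[i0 iN] M0 vM; rewrite /tail -sumrB mulr_sumr; apply: ler_sum => s _.
rewrite -mulrBr mulrCA ler_pM2l//.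
have ax : a <= x i.-1 by rewrite -{1}(grid0 a b N) ler_grid.
have xb : x i.-1 <= b by rewrite -{2}(gridN a b hN) ler_grid//; lia.
rewrite (le_trans (@Rintegral_interp_le _ _ v M a (x i.-1) _ _ _ _ _ _))//.
- exact: continuous_left_kernel.
- apply/seteqP; split=> y /=; rewrite !in_itv /=; first by case=> -> /andP[-> _].
  by move=> /andP[-> yx]; rewrite yx (le_trans yx).
rewrite Rintegral_left_kernel// (_ : x i - x i.-1 = h); last first.
  by rewrite -{1}(prednK i0) gridS addrC addKr.
by rewrite (_ : x i - a = i%:R * h)// /uniform_grid addrC addKr.
Qed.

Lemma right_integral_le v i M : (0 < i < N)%N -> 0 <= M ->
  (forall k, interior_part v k <= M) ->
  \sum_(s < Ne) theta s * \int[leb]_(y in `[x i.+1, +oo[)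
     (expR (- lambda s * (y - x i)) * interp x v y)
  <= M * (tail h - tail ((N - i)%:R * h)).
Proof.
move=> /andP[i0 iN] M0 vM; rewrite /tail -sumrB mulr_sumr; apply: ler_sum => s _.
rewrite -mulrBr mulrCA ler_pM2l//.
have ax : a <= x i.+1 by rewrite -{1}(grid0 a b N) ler_grid.
have xb : x i.+1 <= b by rewrite -{2}(gridN a b hN) ler_grid.
rewrite (le_trans (@Rintegral_interp_le _ _ v M (x i.+1) b _ _ _ _ _ _))//.
- exact: continuous_right_kernel.
- apply/seteqP; split=> y /=; rewrite !in_itv /= ?andbT; first by case=> -> /andP[_ ->].
  by move=> /andP[xy ->]; rewrite xy (le_trans ax).
rewrite Rintegral_right_kernel// gridS [x i + h - _]addrAC subrr add0r.
by rewrite -(gridB a b N (ltnW iN)) gridN.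
Qed.

(** Used for half-lines that start at a node: they contain an open cell or miss
    it, and P selects the cells contained. *)
Lemma Rintegral_interp' (e : R -> R) (D : set (measurableTypeR R)) v (P : pred nat) :
  continuous e -> measurable D ->
  (forall k, P k -> `]x k, x k.+1[ `<=` D) ->
  (forall k, ~~ P k -> D `&` `]x k, x k.+1[ = set0) ->
  \int[leb]_(y in D) (e y * interp' x v y) =
  \sum_(k < N | P k) slope a b v k * \int[leb]_(y in `[x k, x k.+1]) e y.
Proof.
move=> ce mD PD nPD.
have i1 k : leb.-integrable D
    (EFin \o (fun y => e y * \1_(`]x k, x k.+1[%classic : set (measurableTypeR R)) y)).
  apply: (integrable_mul_supported (a := x k) (b := x k.+1) (B := 1)) => //.
  - by move=> y; rewrite indicE; case: (_ \in _); rewrite ?normr1 ?normr0.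
  - move=> y yk; rewrite indicE memNset//= in_itv /=; case: yk; lra.
transitivity (\int[leb]_(y in D) (\sum_(k < N) slope a b v k *
    (e y * \1_(`]x k, x k.+1[%classic : set (measurableTypeR R)) y))).
  apply: eq_Rintegral => y _; rewrite interp'E// mulr_sumr.
  by apply: eq_bigr => k _; rewrite mulrCA.
rewrite Rintegral_sum//; last by move=> k; exact: (integrableZl mD _ (i1 k)).
rewrite [RHS]big_mkcond /=; apply: eq_bigr => k _.
rewrite RintegralZl//.
transitivity (slope a b v k * \int[leb]_(y in D `&` `]x k, x k.+1[) e y).
  rewrite Rintegral_mkcondr; congr (_ * _); apply: eq_Rintegral => y _.
  by rewrite patchE indicE; case: (_ \in _); rewrite ?mulr1 ?mulr0.
case: ifPn => [Pk|/nPD ->]; last by rewrite Rintegral_set0 mulr0.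
rewrite (setIidr (PD _ Pk)).
have ie : leb.-integrable `[x k, x k.+1] (EFin \o e).
  apply: continuous_compact_integrable; first exact: segment_compact.
  exact: continuous_subspaceT.
congr (_ * _); rewrite Rintegral_itv_bndo_bndc; last first.
  by apply: integrableS ie => //; exact: subset_itv_oo_cc.
rewrite Rintegral_itv_obnd_cbnd//.
by apply: integrableS ie => //; exact: subset_itv_oc_cc.
Qed.

End Tails.

(** * Properties of the exponential sum *)

(** Summation by parts, as an induction on partial sums: those of
    (w_d - w_(d+1)) mu_d stay above (w_0 - w_(m+1)) mu_m, since replacing mu_m
    by a smaller weight can only decrease a nonnegative multiple of it. *)
Lemma abel_sum_gt0 (R : realFieldType) n (w mu : nat -> R) :
  0 < w 0%N -> w n.+1 = 0 -> (forall d, w d <= w 0%N) ->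
  (forall d, (d < n)%N -> mu d.+1 <= mu d) -> 0 < mu n ->
  0 < \sum_(d < n.+1) (w d - w d.+1) * mu d.
Proof.
move=> w0 wn wmax mudec mun.
have claim m : (m <= n)%N ->
    (w 0%N - w m.+1) * mu m <= \sum_(d < m.+1) (w d - w d.+1) * mu d.
  elim: m => [|m IHm] mn; first by rewrite big_ord1.
  rewrite big_ord_recr /=; have := IHm (ltnW mn).
  have : (w 0%N - w m.+1) * mu m.+1 <= (w 0%N - w m.+1) * mu m.
    by rewrite ler_wpM2l ?subr_ge0// mudec.
  lra.
by rewrite (lt_le_trans _ (claim n (leqnn n)))// wn subr0 mulr_gt0.
Qed.

Section ExponentialSum.
Variable R : realType.
Variables (Ne : nat) (lambda theta : 'I_Ne -> R).
Hypotheses (Ne_gt0 : (0 < Ne)%N).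
Hypotheses (lambda_gt0 : forall s, 0 < lambda s) (theta_gt0 : forall s, 0 < theta s).
Local Notation tail := (tail lambda theta).
Implicit Types t d : R.

Definition exp_sum t : R := \sum_(s < Ne) theta s * expR (- lambda s * t).

Lemma is_derive_tail t : is_derive t 1 tail (- exp_sum t).
Proof.
pose F s := (theta s / lambda s) \*: (fun t => expR (- lambda s * t + 0)).
have -> : tail = \sum_(s < Ne) F s.
  apply/funext => u; rewrite fct_sumE; apply: eq_bigr => s _.
  by rewrite /F /= /GRing.scale /= addr0; ring.
rewrite /exp_sum -sumrN; apply: is_derive_sum => s.
apply: (is_derive_eq (is_deriveZ _ (is_derive_expR_affine _ _ _))).
by rewrite addr0 /GRing.scale /=; field; rewrite gt_eqF.
Qed.

(** The exponential sum decreases, so it is at most its value at t on [t, t+d].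
    Termwise this is 1 - exp(- x) <= x. *)
Lemma tail_diff_le t d : 0 <= d -> tail t - tail (t + d) <= d * exp_sum t.
Proof.
move=> d0; rewrite /tail /exp_sum -sumrB mulr_sumr; apply: ler_sum => s _.
rewrite -mulrBr mulrCA ler_pM2l// -mulrBl ler_pdivrMr//.
rewrite mulrDr expRD; have := expR_ge1Dx (- lambda s * d).
have := expR_ge0 (- lambda s * t); set A := expR _; set B := expR _ => A0 hB.
have : A * (1 - B) <= A * (lambda s * d) by rewrite ler_wpM2l//; lra.
lra.
Qed.

Lemma tail_diff_gt0 t d : 0 < d -> 0 < tail t - tail (t + d).
Proof.
move=> d0; rewrite /tail -sumrB.
have pos s : 0 < theta s * (expR (- lambda s * t) / lambda s) -
    theta s * (expR (- lambda s * (t + d)) / lambda s).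
  rewrite -mulrBr mulr_gt0// -mulrBl divr_gt0// subr_gt0 ltr_expR.
  by rewrite !mulNr ltrN2 ltr_pM2l// ltrDl.
rewrite (bigD1 (Ordinal Ne_gt0))//= ltr_pwDl// sumr_ge0// => s _.
exact: ltW.
Qed.

Lemma tail_convex t d : 0 <= d ->
  tail (t + d) - tail (t + d + d) <= tail t - tail (t + d).
Proof.
move=> d0; rewrite /tail -!sumrB; apply: ler_sum => s _.
rewrite -!mulrBr ler_pM2l// -!mulrBl ler_pM2r ?invr_gt0//.
rewrite !mulrDr !expRD; set A := expR _; set B := expR _.
have A0 : 0 <= A := expR_ge0 _.
have : 0 <= A * (1 - B) ^+ 2 by rewrite mulr_ge0 ?sqr_ge0.
lra.
Qed.

End ExponentialSum.

(** * The discrete maximum principle *)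

Section MaximumPrinciple.
Variables (R : realType) (a b : R) (N : nat).
Hypotheses (hab : a < b) (hN : (0 < N)%N).
Variables (Ne : nat) (lambda theta : 'I_Ne -> R) (alpha eps Dx X : R).
Hypothesis alpha_gt0 : 0 < alpha.
Local Notation h := ((b - a) / N%:R).
Local Notation x := (uniform_grid a b N).
Hypothesis soe : SOE_approximation alpha N x eps Dx X lambda theta.
Local Notation tail := (tail lambda theta).
Local Notation exp_sum := (exp_sum lambda theta).
Implicit Types (t : R) (i k d : nat) (v : 'rV[R]_N.+1).

Local Notation lambda_gt0 := (soe_lambda_gt0 soe).
Local Notation theta_gt0 := (soe_theta_gt0 soe).
Local Notation h_gt0 := (step_gt0 hab hN).

Lemma exp_sum_le t : h <= t <= b - a ->
  exp_sum t <= t `^ (- soe_exponent alpha) + eps.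
Proof.
move=> /andP[ht tX].
have := soe_error soe (t := t); have := soe_Dx_le soe (j := 1) hN.
rewrite mesh_grid// => Dh; have := soe_X_ge soe; rewrite gridN// grid0 => Xab.
move=> /(_ ltac:(lra)); rewrite -/(exp_sum t) ler_norml; lra.
Qed.

Section SmallExponent.
Hypothesis alpha_lt1 : alpha < 1.

(** The function T(t) - t^(-alpha) / alpha + eps t has derivative
    - K(t) + t^(-1-alpha) + eps, which the error bound makes nonnegative. *)
Lemma tail_diff_le_powR t : h <= t <= b - a ->
  tail h - tail t <= (h `^ (- alpha) - t `^ (- alpha)) / alpha + eps * (t - h).
Proof.
move=> /andP[ht tab]; have h0 := h_gt0.
pose G := tail + ((- alpha^-1) \*: (fun t => t `^ (- alpha)) + eps \*: (@id R)).
pose dG u := - exp_sum u + ((- alpha^-1) *: (- alpha * u `^ (- alpha - 1)) + eps *: 1).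
have dG_at u : h <= u -> is_derive u 1 G (dG u).
  move=> hu; have u0 : 0 < u := lt_le_trans h0 hu.
  apply: is_deriveD; first exact: (is_derive_tail theta lambda_gt0 u).
  apply: is_deriveD; apply: is_deriveZ.
  exact: is_derive1_powR.
have dGE u : u \in `]h, t[ -> is_derive u 1 G (dG u).
  rewrite in_itv /= => /andP[hu _]; exact: dG_at (ltW hu).
have cG : {within `[h, t], continuous G}.
  apply: continuous_in_subspaceT => u; rewrite inE /= in_itv /= => /andP[hu _].
  apply: differentiable_continuous; apply/derivable1_diffP.
  by have [] := dG_at u hu.
have [c cht Gc] := MVT_segment ht dGE cG.
have /andP[hc ct] : h <= c <= t by move: cht; rewrite in_itv.
have dG0 : 0 <= dG c.
  have := @exp_sum_le c; rewrite hc (le_trans ct tab) => /(_ isT).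
  rewrite /soe_exponent alpha_lt1 (_ : - (1 + alpha) = - alpha - 1); last by ring.
  rewrite /dG /GRing.scale /= mulr1 mulrA mulrNN mulVf ?gt_eqF// mul1r; lra.
have : 0 <= G t - G h by rewrite Gc mulr_ge0// subr_ge0.
have GE u : G u = tail u + (- alpha^-1 * u `^ (- alpha) + eps * u) by [].
by rewrite !GE; set p := h `^ _; set q := t `^ _; lra.
Qed.

(** The slack t^(-alpha) / alpha is at least (b-a)^(-alpha) / alpha, and it absorbs
    the accumulated error eps (t - h) < eps (b - a). *)
Lemma tail_gap t : h <= t <= b - a ->
  0 < eps -> eps <= (b - a) `^ (- alpha) / (alpha * (b - a)) ->
  tail h - tail t < h `^ (- alpha) / alpha.
Proof.
move=> ht eps0; have h0 := h_gt0; have ba : 0 < b - a by rewrite subr_gt0.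
rewrite ler_pdivlMr ?mulr_gt0// => eps_le.
apply: (le_lt_trans (tail_diff_le_powR ht)).
rewrite mulrBl -addrA gtrDl addrC subr_lt0 ltr_pdivlMr//.
have /andP[ht1 ht2] := ht; have t0 : 0 < t by lra.
apply: lt_le_trans (le_powRN alpha_gt0 t0 ht2); apply: lt_le_trans eps_le.
rewrite -mulrA ltr_pM2l// mulrC ltr_pM2l//; lra.
Qed.

End SmallExponent.

Section LargeExponent.
Hypothesis alpha_ge1 : 1 <= alpha.

(** Weight of the grid difference at distance d from the collocation node: the
    mean of the exponential sum over a cell, except for the cell next to the
    node, whose weight is the local coefficient of the scheme. *)
Definition cell_weight d : R :=
  if d is 0 then h `^ (- alpha)
  else (tail (d%:R * h) - tail (d.+1%:R * h)) / h.

Let natrS_mulh d : d.+2%:R * h = d.+1%:R * h + h.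
Proof. by rewrite -[d.+2%:R]natr1; ring. Qed.

Lemma cell_weight_gt0 d : 0 < cell_weight d.
Proof.
case: d => [|d]; first by rewrite powR_gt0// h_gt0.
rewrite /cell_weight divr_gt0 ?h_gt0// natrS_mulh.
apply: (tail_diff_gt0 (soe_size soe) lambda_gt0 theta_gt0).
exact: h_gt0.
Qed.

(** For d >= 1 this is convexity of the tail. For d = 0, bounding the exponential
    sum on the two halves of [h, 2h] by its values at h and 3h/2 gives
    mu_1 <= (h^(-alpha) + (3h/2)^(-alpha)) / 2 + eps, and eps is at most half of
    the gap between the two powers. *)
Lemma cell_weight_decr d : (1 < N)%N ->
  eps <= (h `^ (- alpha) - (3 / 2 * h) `^ (- alpha)) / 2 ->
  cell_weight d.+1 <= cell_weight d.
Proof.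
move=> N1 eps_le; case: d => [|d]; last first.
  rewrite /cell_weight ler_pM2r ?invr_gt0 ?h_gt0//.
  rewrite !natrS_mulh.
  by apply: (tail_convex lambda_gt0 theta_gt0); exact: ltW h_gt0.
have h0 := h_gt0; rewrite /cell_weight ler_pdivrMr// (mul1r h).
have N2 : 2 * h <= b - a.
  rewrite -[leRHS](@divfK _ N%:R) ?pnatr_eq0 -?lt0n//.
  by rewrite mulrC ler_pM2l// ler_nat.
have h2 : 0 <= h / 2 by lra.
have t1 := tail_diff_le lambda_gt0 theta_gt0 h h2.
have t2 := tail_diff_le lambda_gt0 theta_gt0 (h + h / 2) h2.
have e1 := @exp_sum_le h ltac:(lra).
have e2 := @exp_sum_le (h + h / 2) ltac:(lra).
rewrite /soe_exponent ltNge alpha_ge1 /= in e1 e2.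
have E : h + h / 2 = 3 / 2 * h by field; rewrite pnatr_eq0 -lt0n.
rewrite E in t1 t2 e2.
rewrite (_ : 3 / 2 * h + h / 2 = 2 * h) in t2; last by field; rewrite pnatr_eq0 -lt0n.
set A := exp_sum _ in t1 e1; set B := exp_sum _ in t2 e2.
have : h / 2 * (A + B) <= h / 2 * (2 * h `^ (- alpha)) by rewrite ler_wpM2l//; lra.
lra.
Qed.

Let vcoord_interior v k : vcoord v 0 = 0 -> vcoord v N = 0 -> (k <= N)%N ->
  vcoord v k = interior_part v k.
Proof.
move=> v0 vN kN; rewrite /interior_part; case: ifP => //.
by case: (posnP k) => [-> //|k0]; case: ltngtP kN => // ->.
Qed.

Let sum_left_cell i k : (k < i)%N ->
  \sum_(s < Ne) theta s *
    \int[lebesgue_measure]_(y in `[x k, x k.+1]) expR (- lambda s * (x i - y)) =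
  tail ((i - k.+1)%:R * h) - tail ((i - k)%:R * h).
Proof.
move=> ki; rewrite /tail -sumrB; apply: eq_bigr => s _; rewrite -mulrBr; congr (_ * _).
rewrite (Rintegral_left_kernel a b N lambda_gt0) ?ler_grid//.
by rewrite (gridB a b N ki) (gridB a b N (ltnW ki)).
Qed.

Let sum_right_cell i k : (i < k)%N ->
  \sum_(s < Ne) theta s *
    \int[lebesgue_measure]_(y in `[x k, x k.+1]) expR (- lambda s * (y - x i)) =
  tail ((k - i)%:R * h) - tail ((k - i).+1%:R * h).
Proof.
move=> ik; rewrite /tail -sumrB; apply: eq_bigr => s _; rewrite -mulrBr; congr (_ * _).
rewrite (Rintegral_right_kernel a b N lambda_gt0) ?ler_grid//.
by rewrite (gridB a b N (ltnW ik)) (gridB a b N (leqW (ltnW ik))) subSn// ltnW.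
Qed.

(** The cell [x_k, x_(k+1)] is at distance d = i - k - 1 from x_i, hence the
    reversal of the summation index. *)
Lemma ell_abel v i : vcoord v 0 = 0 -> vcoord v N = 0 -> (0 < i < N)%N ->
  ell alpha x lambda theta v i =
  alpha^-1 * \sum_(d < i)
    (interior_part v (i - d) - interior_part v (i - d.+1)) * cell_weight d.
Proof.
move=> v0 vN /andP[i0 iN]; rewrite /ell ltNge alpha_ge1 /= mesh_grid//.
have combine m p p' q q' S T : p = p' -> q = q' -> S = T ->
    m / alpha * (p - q) + alpha^-1 * S = alpha^-1 * ((p' - q') * m + T).
  by move=> -> -> ->; ring.
case: i i0 iN => // i _ iN; rewrite [in RHS]big_ord_recl /= subn0 subSS subn0.
apply: combine; [exact: vcoord_interior (ltnW iN)| |].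
  by apply: vcoord_interior => //; lia.
under eq_bigr => s _.
  rewrite (@Rintegral_interp' _ a b N hab hN _ [set` `]-oo, x i]] v
    (fun k => (k < i)%N) (@continuous_left_kernel _ a b N _ lambda i.+1 s)
    (measurable_itv _)); last 2 first.
  - move=> k ki y /=; rewrite !in_itv /= => /andP[_ /ltW yk].
    by rewrite (le_trans yk)// ler_grid.
  - move=> k; rewrite -leqNgt => ik; apply/seteqP; split => // y [] /=.
    rewrite !in_itv /= => yi /andP[ky _].
    by have := lt_le_trans ky yi; rewrite ltr_grid// ltnNge ik.
  rewrite -(big_ord_widen N (fun k => slope a b v k *
    \int[lebesgue_measure]_(y in `[x k, x k.+1]) expR (- lambda s * (x i.+1 - y))));
    last by lia.
  rewrite mulr_sumr; over.
rewrite exchange_big /= (reindex_inj rev_ord_inj) /=; apply: eq_bigr => d _.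
under eq_bigr => s _ do rewrite mulrCA.
rewrite -mulr_sumr sum_left_cell; last by lia.
have -> : (i.+1 - (i - d.+1).+1 = d.+1)%N by have := ltn_ord d; lia.
have -> : (i.+1 - (i - d.+1) = d.+2)%N by have := ltn_ord d; lia.
rewrite /slope /cell_weight /bump /= add1n !subSS.
have -> : ((i - d.+1).+1 = i - d)%N by have := ltn_ord d; lia.
by rewrite mulrAC -mulrA.
Qed.

(** Here the cell [x_k, x_(k+1)] is at distance d = k - i. *)
Lemma rho_abel v i : vcoord v 0 = 0 -> vcoord v N = 0 -> (0 < i < N)%N ->
  rho alpha x lambda theta v i =
  alpha^-1 * \sum_(d < N - i)
    (interior_part v (i + d) - interior_part v (i + d.+1)) * cell_weight d.
Proof.
move=> v0 vN /andP[i0 iN]; rewrite /rho ltNge alpha_ge1 /= mesh_grid//.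
have combine m p p' q q' S T : p = p' -> q = q' -> - S = T ->
    m / alpha * (p - q) - alpha^-1 * S = alpha^-1 * ((p' - q') * m + T).
  by move=> -> -> <-; ring.
have -> : (N - i = (N - i.+1).+1)%N by lia.
rewrite [in RHS]big_ord_recl /= addn0 addn1.
apply: combine; [exact: vcoord_interior (ltnW iN)|exact: vcoord_interior|].
under eq_bigr => s _.
  rewrite (@Rintegral_interp' _ a b N hab hN _ [set` `[x i.+1, +oo[] v
    (fun k => (i < k)%N) (@continuous_right_kernel _ a b N _ lambda i s)
    (measurable_itv _)); last 2 first.
  - move=> k ik y /=; rewrite !in_itv /= andbT => /andP[/ltW ky _].
    by rewrite (le_trans _ ky)// ler_grid.
  - move=> k; rewrite -leqNgt => ki; apply/seteqP; split => // y [] /=.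
    rewrite !in_itv /= andbT => iy /andP[_ yk].
    by have := le_lt_trans iy yk; rewrite ltr_grid// ltnS ltnNge ki.
  rewrite mulr_sumr; over.
rewrite exchange_big /= -sumrN.
transitivity (\sum_(i.+1 <= k < N) - \sum_(s < Ne) theta s * (slope a b v k *
    \int[lebesgue_measure]_(y in `[x k, x k.+1]) expR (- lambda s * (y - x i)))).
  by rewrite (@big_nat_widenl _ _ _ i.+1 0 N xpredT)// big_mkord.
rewrite -{1}[i.+1]add0n big_addn big_mkord; apply: eq_bigr => d _.
under eq_bigr => s _ do rewrite mulrCA.
rewrite -mulr_sumr sum_right_cell; last by lia.
have -> : (d + i.+1 - i = d.+1)%N by lia.
rewrite /slope /cell_weight /bump /= add1n !addnS [(d + i)%N]addnC.
by rewrite mulrAC -mulrA -mulNr opprB.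
Qed.

Hypothesis eps_le : eps <= (h `^ (- alpha) - (3 / 2 * h) `^ (- alpha)) / 2.

Lemma ell_gt0_large v i : vcoord v 0 = 0 -> vcoord v N = 0 -> (0 < i < N)%N ->
  (forall k, interior_part v k <= vcoord v i) -> 0 < vcoord v i ->
  0 < ell alpha x lambda theta v i.
Proof.
move=> v0 vN iN vmax vi; rewrite ell_abel// mulr_gt0 ?invr_gt0//.
have viE : interior_part v i = vcoord v i by rewrite /interior_part iN.
case: i iN vmax vi viE => // i iN vmax vi viE.
apply: (@abel_sum_gt0 _ i (fun d => interior_part v (i.+1 - d))).
- by rewrite subn0 viE.
- by rewrite subnn.
- by move=> d; rewrite subn0 viE.
- by move=> d di; apply: cell_weight_decr => //; lia.
- exact: cell_weight_gt0.
Qed.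

Lemma rho_gt0_large v i : vcoord v 0 = 0 -> vcoord v N = 0 -> (0 < i < N)%N ->
  (forall k, interior_part v k <= vcoord v i) -> 0 < vcoord v i ->
  0 < rho alpha x lambda theta v i.
Proof.
move=> v0 vN iN vmax vi; rewrite rho_abel// mulr_gt0 ?invr_gt0//.
have viE : interior_part v i = vcoord v i by rewrite /interior_part iN.
have -> : (N - i = (N - i.+1).+1)%N by lia.
apply: (@abel_sum_gt0 _ _ (fun d => interior_part v (i + d))).
- by rewrite addn0 viE.
- by rewrite /interior_part ifF//; lia.
- by move=> d; rewrite addn0 viE.
- by move=> d di; apply: cell_weight_decr => //; lia.
- exact: cell_weight_gt0.
Qed.

End LargeExponent.

Section SmallExponentMaximum.
Hypothesis alpha_lt1 : alpha < 1.
Hypothesis eps_gt0 : 0 < eps.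
Hypothesis eps_le : eps <= (b - a) `^ (- alpha) / (alpha * (b - a)).

Let natr_mulh k : (0 < k < N)%N -> h <= k%:R * h <= b - a.
Proof.
move=> /andP[k0 kN]; have h0 := h_gt0; rewrite ler_peMl ?ler1n ?(ltW h0)//=.
rewrite -[leRHS](@divfK _ N%:R) ?pnatr_eq0 -?lt0n//.
by rewrite mulrC ler_pM2l// ler_nat ltnW.
Qed.

Lemma ell_gt0_small v i : (0 < i < N)%N ->
  (forall k, interior_part v k <= vcoord v i) -> 0 < vcoord v i ->
  0 < ell alpha x lambda theta v i.
Proof.
move=> iN vmax vi; rewrite /ell alpha_lt1 mesh_grid//; last by case/andP: iN.
rewrite subr_gt0; apply: (le_lt_trans (left_integral_le hab hN lambda_gt0 theta_gt0
  iN (ltW vi) vmax)).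
by rewrite mulrC ltr_pM2r// tail_gap// natr_mulh.
Qed.

Lemma rho_gt0_small v i : (0 < i < N)%N ->
  (forall k, interior_part v k <= vcoord v i) -> 0 < vcoord v i ->
  0 < rho alpha x lambda theta v i.
Proof.
move=> iN vmax vi; rewrite /rho alpha_lt1 mesh_grid//.
rewrite subr_gt0; apply: (le_lt_trans (right_integral_le hab hN lambda_gt0 theta_gt0
  iN (ltW vi) vmax)).
by rewrite mulrC ltr_pM2r// tail_gap// natr_mulh//; lia.
Qed.

End SmallExponentMaximum.
End MaximumPrinciple.

(** * The linear system *)

Lemma linear_exists_unique (K : fieldType) n (F : 'rV[K]_n -> 'rV[K]_n) :
  linear F -> (forall u, F u = 0 -> u = 0) -> forall w, exists! u, F u = w.
Proof.
move=> linF kerF w.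
pose mF := GRing.isLinear.Build K 'rV[K]_n 'rV[K]_n *:%R F linF.
pose FL : {linear 'rV[K]_n -> 'rV[K]_n} := HB.pack F mF.
have FE u : F u = u *m lin1_mx FL by rewrite mul_rV_lin1.
have free : row_free (lin1_mx FL).
  by apply/inj_row_free => u; rewrite -FE; exact: kerF.
have unit : lin1_mx FL \in unitmx by rewrite -row_free_unit.
exists (w *m invmx (lin1_mx FL)); split; first by rewrite FE mulmxKV.
by move=> u <-; rewrite FE mulmxK.
Qed.

Section BoundarySystem.
Variables (R : realType) (alpha a b : R) (N : nat).
Variables (Ne : nat) (lambda theta : 'I_Ne -> R).
Hypothesis hN : (0 < N)%N.
Local Notation x := (uniform_grid a b N).
Local Notation L_h := (L_h alpha x lambda theta).
Implicit Types (u v : 'rV[R]_N.+1) (i : nat).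

(** The boundary conditions serve as first and last equation, which makes the
    system square on vectors of size N + 1. *)
Definition boundary_system v : 'rV[R]_N.+1 :=
  \row_k if (0 < k < N)%N then L_h v k else v ord0 k.

Lemma boundary_systemP v (f : nat -> R) :
  boundary_system v = \row_k (if (0 < k < N)%N then f k else 0) <->
  [/\ vcoord v 0 = 0, vcoord v N = 0 &
      forall i, (1 <= i <= N.-1)%N -> L_h v i = f i].
Proof.
have val0 : (inord 0 : 'I_N.+1) = 0%N :> nat by rewrite inordK.
have valN : (inord N : 'I_N.+1) = N :> nat by rewrite inordK.
split=> [/rowP E|[v0 vN Lv]]; last first.
  apply/rowP => k; rewrite !mxE; case: ifP => kN; first by rewrite Lv//; lia.
  have [k0|kk] : k = inord 0 \/ k = inord N.
    have := ltn_ord k; case: (posnP k) => k0 kN1; [left|right]; apply: val_inj => /=.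
      by rewrite val0.
    by rewrite valN; lia.
  - by rewrite k0.
  - by rewrite kk.
split.
- by have := E (inord 0); rewrite !mxE val0.
- by have := E (inord N); rewrite !mxE valN ltnn andbF.
- move=> i iN; have vali : (inord i : 'I_N.+1) = i :> nat by rewrite inordK; lia.
  have iN' : (0 < i < N)%N by lia.
  by have := E (inord i); rewrite !mxE vali iN'.
Qed.

Hypothesis hab : a < b.

(** Equal mesh sizes make eta vanish, and with it the local part. *)
Lemma L_h_uniform v i : (0 < i)%N ->
  L_h v i = C_ alpha * (ell alpha x lambda theta v i + rho alpha x lambda theta v i).
Proof.
move=> i0; rewrite /Defs.L_h /L_loc /Defs.eta !mesh_grid// !subrr !mul0r if_same.
by rewrite mulr0 addr0.
Qed.

Lemma L_h_linear c u v i : (0 < i)%N -> L_h (c *: u + v) i = c * L_h u i + L_h v i.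
Proof.
have combine (L Lu Lv C p pu pv q qu qv : R) :
    L = C * (p + q) -> Lu = C * (pu + qu) -> Lv = C * (pv + qv) ->
    p = c * pu + pv -> q = c * qu + qv -> L = c * Lu + Lv.
  by move=> -> -> -> -> ->; ring.
move=> i0; apply: combine (L_h_uniform _ i0) (L_h_uniform _ i0) (L_h_uniform _ i0) _ _.
  exact: ell_linear.
exact: rho_linear.
Qed.

Lemma boundary_system_linear : linear boundary_system.
Proof.
move=> c u v; apply/rowP => k; rewrite !mxE.
by case: ifP => // /andP[k0 _]; rewrite L_h_linear.
Qed.

End BoundarySystem.

Section UniqueSolvability.
Variables (R : realType) (alpha a b : R) (N : nat).
Hypotheses (halpha : 0 < alpha < 2) (hab : a < b) (hN : (0 < N)%N).
Local Notation h := ((b - a) / N%:R).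
Local Notation x := (uniform_grid a b N).

(** For alpha < 1 this bounds eps (b - a) by the last slack (b-a)^(-alpha) / alpha;
    for alpha >= 1 it makes the weights of the first two cells decrease. *)
Definition tolerance : R :=
  if alpha < 1 then (b - a) `^ (- alpha) / (alpha * (b - a))
  else (h `^ (- alpha) - (3 / 2 * h) `^ (- alpha)) / 2.

Lemma tolerance_gt0 : 0 < tolerance.
Proof.
have /andP[a0 _] := halpha; have ba : 0 < b - a by rewrite subr_gt0.
rewrite /tolerance; case: ifP => _; first by rewrite divr_gt0 ?powR_gt0 ?mulr_gt0.
have h0 := step_gt0 hab hN.
by rewrite divr_gt0// subr_gt0 lt_powRN//; lra.
Qed.

Variables (eps Dx X : R) (Ne : nat) (lambda theta : 'I_Ne -> R).
Hypothesis heps : 0 < eps <= tolerance.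
Hypothesis soe : SOE_approximation alpha N x eps Dx X lambda theta.
Implicit Types (u v : 'rV[R]_N.+1) (i : nat).
Local Notation L_h := (L_h alpha x lambda theta).
Local Notation boundary_system := (boundary_system alpha a b lambda theta).

Lemma L_h_gt0_max v i : vcoord v 0 = 0 -> vcoord v N = 0 -> (0 < i < N)%N ->
  (forall k, interior_part v k <= vcoord v i) -> 0 < vcoord v i -> 0 < L_h v i.
Proof.
move=> v0 vN iN vmax vi; have /andP[a0 _] := halpha.
rewrite L_h_uniform; last by case/andP: iN.
rewrite mulr_gt0 ?C_gt0//.
have /andP[e0] := heps; rewrite /tolerance; case: ltP => [a1|a1] el.
  by rewrite addr_gt0// ?(ell_gt0_small hab hN a0 soe)// (rho_gt0_small hab hN a0 soe).
by rewrite addr_gt0// ?(ell_gt0_large hab hN a0 soe)// (rho_gt0_large hab hN a0 soe).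
Qed.

(** A positive maximum would be attained at an interior node, where the operator
    would be positive. *)
Lemma L_h_eq0_le0 v : vcoord v 0 = 0 -> vcoord v N = 0 ->
  (forall i, (0 < i < N)%N -> L_h v i = 0) -> forall j : 'I_N.+1, v ord0 j <= 0.
Proof.
move=> v0 vN Lv j; rewrite leNgt; apply/negP => vj.
have [m _ mmax] := @arg_maxP _ _ _ j xpredT (v ord0) isT.
have vm : 0 < v ord0 m by apply: lt_le_trans vj (mmax j isT).
have vmE : vcoord v m = v ord0 m by rewrite /vcoord inord_val.
have mN : (0 < m < N)%N.
  rewrite lt0n ltn_neqAle -ltnS ltn_ord andbT.
  by apply/andP; split; apply: contraTN vm => /eqP mE; rewrite -vmE mE ?v0 ?vN ltxx.
suff : 0 < L_h v m by rewrite Lv// ltxx.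
apply: L_h_gt0_max => //; rewrite vmE// => k.
by rewrite /interior_part; case: ifP => _; [exact: mmax|exact: ltW].
Qed.

(** The maximum principle applied to v and to - v. *)
Lemma boundary_system_ker v : boundary_system v = 0 -> v = 0.
Proof.
move=> Bv0; have lin := boundary_system_linear alpha lambda theta hN hab.
have nonpos u : boundary_system u = 0 -> forall k, u ord0 k <= 0.
  move=> Bu0; have [|u0 uN Lu] := (boundary_systemP alpha a b lambda theta hN u (fun=> 0)).1.
    by rewrite Bu0; apply/rowP => k; rewrite !mxE if_same.
  by apply: L_h_eq0_le0 => // i iN; apply: Lu; lia.
have BN : boundary_system (- v) = 0.
  have B0 : boundary_system (0 : 'rV[R]_N.+1) = 0.
    have := lin (-1) 0 0.
    by rewrite scaler0 addr0 scaleN1r addNr.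
  by rewrite -[- v]addr0 -scaleN1r lin Bv0 B0 scaler0 addr0.
apply/rowP => k; apply/eqP; rewrite mxE eq_le nonpos//=.
by have := nonpos _ BN k; rewrite mxE oppr_le0.
Qed.

End UniqueSolvability.

Unset Implicit Arguments.

Theorem theorem2p4 (R : realType) (alpha a b : R) (N : nat)
    (halpha : 0 < alpha < 2) (hab : a < b) (hN : (0 < N)%N) :
  exists eps0 : R, 0 < eps0 /\
    forall eps : R, 0 < eps <= eps0 ->
    forall (Dx X : R) (Ne : nat) (lambda theta : 'I_Ne -> R),
      SOE_approximation alpha N (uniform_grid a b N) eps Dx X lambda theta ->
    forall f : nat -> R,
      exists! U : 'rV[R]_N.+1,
        [/\ vcoord U 0 = 0, vcoord U N = 0 &
            forall i : nat, (1 <= i <= N.-1)%N ->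
              L_h alpha (uniform_grid a b N) lambda theta U i = f i].
Proof.
exists (tolerance alpha a b N); split; first exact: tolerance_gt0.
move=> eps heps Dx X Ne lambda theta soe f.
have [U [BU Uuniq]] := linear_exists_unique
  (boundary_system_linear alpha lambda theta hN hab)
  (boundary_system_ker halpha hab hN heps soe)
  (\row_k (if (0 < k < N)%N then f k else 0)).
have solves V := boundary_systemP alpha a b lambda theta hN V f.
exists U; split; first exact: (solves U).1.
by move=> V /(solves V).2; exact: Uuniq.
Qed.
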